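(* The coincidence site lattices of $L$ are precisely the lattices of the form $$L\cap\frac{1}{|q\widetilde q|}\,qL\widetilde q$$ with $q\in\mathbb{I}$ primitive and admissible.
   Context: Let $K=\mathbb{Q}(\sqrt5)$, $\tau=(1+\sqrt5)/2$, $\mathfrak{o}=\mathbb{Z}[\tau]$ (the ring of integers of $K$), $\mathbb{N}=\{1,2,3,\dots\}$, and let ${}'$ denote the algebraic conjugation of $K$ induced by $\sqrt5\mapsto-\sqrt5$. Let $\mathbb{H}(K)=K\oplus \mathrm{i}K\oplus \mathrm{j}K\oplus \mathrm{k}K$ be the Hamilton quaternion algebra over $K$ ($\mathrm{i}^2=\mathrm{j}^2=\mathrm{k}^2=\mathrm{ijk}=-1$), with elements written $q=(a,b,c,d)=a+\mathrm{i}b+\mathrm{j}c+\mathrm{k}d$. The norm $|q|$ is the Euclidean length, $|q|^2=q\bar q$ with $\bar q=(a,-b,-c,-d)$. The twist map is $\widetilde q=(a',b',d',c')$. The icosian ring is $$\mathbb{I}=\big\langle(1,0,0,0),(0,1,0,0),\tfrac12(1,1,1,1),\tfrac12(1-\tau,\tau,0,1)\big\rangle_{\mathfrak{o}},$$ and $$L=\big\langle(1,0,0,0),\tfrac12(-1,1,1,1),(0,-1,0,0),\tfrac12(0,1,\tau-1,-\tau)\big\rangle_{\mathbb{Z}}\subset\mathbb{I}$$ is a lattice in $\mathbb{R}^4$ (quaternions viewed as vectors in $\mathbb{R}^4$); it is a copy of the root lattice $A_4$ with respect to the inner product $\mathrm{tr}(x\bar y)=x\bar y+y\bar x$. An element $q\in\mathbb{I}$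 is primitive if $\alpha q\in\mathbb{I}$ with $\alpha\in K$ implies $\alpha\in\mathfrak{o}$. An element $q\in\mathbb{I}$ is admissible if $|q\widetilde q|\in\mathbb{N}$. A coincidence isometry of $L$ is an $R\in\mathrm{O}(4,\mathbb{R})$ such that $L$ and $RL$ are commensurate, i.e. share a common (full-rank) sublattice; the corresponding coincidence site lattice (CSL) is $L\cap RL$. The coincidence site lattices of $L$ are all lattices $L\cap RL$ for $R$ a coincidence isometry of $L$. *)

(* Defs.v *)
From HB Require Import structures.
From mathcomp Require Import all_boot all_order all_algebra ring.
From mathcomp Require Import classical_sets reals.

Set Implicit Arguments.
Unset Strict Implicit.
Unset Printing Implicit Defensive.

Import Order.TTheory GRing.Theory Num.Theory.

Local Open Scope classical_set_scope.
Local Open Scope ring_scope.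

(* [Qs5 a b] is the element a + b sqrt 5 of K = Q(sqrt 5). *)
Record Qsqrt5 : Type := Qs5 { ratpart : rat; s5part : rat }.

Definition Qsqrt5_pair (x : Qsqrt5) := (ratpart x, s5part x).
Definition pair_Qsqrt5 (p : rat * rat) := Qs5 p.1 p.2.
Lemma Qsqrt5_pairK : cancel Qsqrt5_pair pair_Qsqrt5. Proof. by case. Qed.

HB.instance Definition _ := Countable.copy Qsqrt5 (can_type Qsqrt5_pairK).

Definition addK (x y : Qsqrt5) :=
  Qs5 (ratpart x + ratpart y) (s5part x + s5part y).
Definition oppK (x : Qsqrt5) := Qs5 (- ratpart x) (- s5part x).
Definition mulK (x y : Qsqrt5) :=
  Qs5 (ratpart x * ratpart y + 5 * (s5part x * s5part y))
      (ratpart x * s5part y + s5part x * ratpart y).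
Definition fieldnormK (x : Qsqrt5) : rat := ratpart x ^+ 2 - 5 * s5part x ^+ 2.
Definition invK (x : Qsqrt5) :=
  Qs5 (ratpart x / fieldnormK x) (- s5part x / fieldnormK x).

Fact addKA : associative addK.
Proof. by move=> [a b] [c d] [e f]; rewrite /addK /= !addrA. Qed.
Fact addKC : commutative addK.
Proof. by move=> [a b] [c d]; congr Qs5; rewrite /= addrC. Qed.
Fact add0K : left_id (Qs5 0 0) addK.
Proof. by move=> [a b]; rewrite /addK /= !add0r. Qed.
Fact addNK : left_inverse (Qs5 0 0) oppK addK.
Proof. by move=> [a b]; rewrite /addK /= !addNr. Qed.

HB.instance Definition _ :=
  GRing.isZmodule.Build Qsqrt5 addKA addKC add0K addNK.

Fact mulKA : associative mulK.
Proof. by move=> [a b] [c d] [e f]; congr Qs5; rewrite /=; ring. Qed.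
Fact mulKC : commutative mulK.
Proof. by move=> [a b] [c d]; congr Qs5; rewrite /=; ring. Qed.
Fact mul1K : left_id (Qs5 1 0) mulK.
Proof. by move=> [a b]; congr Qs5; rewrite /=; ring. Qed.
Fact mulKDl : left_distributive mulK addK.
Proof. by move=> [a b] [c d] [e f]; congr Qs5; rewrite /=; ring. Qed.
Fact oneK_neq0 : Qs5 1 0 != 0.
Proof. by []. Qed.

HB.instance Definition _ :=
  GRing.Zmodule_isComNzRing.Build Qsqrt5 mulKA mulKC mul1K mulKDl oneK_neq0.

Lemma sqrt5_irrational (a b : rat) : a ^+ 2 = 5 * b ^+ 2 -> b = 0.
Proof.
move=> e; apply/eqP; apply: contraT => b0.
have a0 : a != 0.
  by rewrite -sqrf_eq0 e mulf_neq0 // sqrf_eq0.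
have : (numq a * denq b) ^+ 2 = 5 * (numq b * denq a) ^+ 2.
  apply: (@intr_inj rat); rewrite !(rmorphM, rmorphXn) /=.
  rewrite !numqE; move: (_%:~R) (_%:~R) => x y.
  by transitivity (a ^+ 2 * (x * y) ^+ 2); [ring | rewrite e; ring].
move/(congr1 absz); rewrite abszM !abszX !abszM.
move/(congr1 (logn 5)); rewrite lognM ?expn_gt0 ?muln_gt0 ?absz_gt0 ?numq_eq0
  ?denq_eq0 ?a0 ?b0 // !lognX.
by move/(congr1 odd); rewrite oddD !oddM.
Qed.

Lemma fieldnormK_eq0 (x : Qsqrt5) : fieldnormK x = 0 -> x = 0.
Proof.
case: x => a b; rewrite /fieldnormK /= => /subr0_eq e.
have b0 := sqrt5_irrational e.
by move: e; rewrite b0 expr0n mulr0 => /eqP; rewrite sqrf_eq0 => /eqP ->.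
Qed.

Fact mulVK (x : Qsqrt5) : x != 0 -> mulK (invK x) x = 1.
Proof.
move=> x0.
have n0 : fieldnormK x != 0.
  by apply: contra x0 => /eqP /fieldnormK_eq0 ->.
case: x n0 {x0} => a b; rewrite /invK /mulK /fieldnormK /= => n0.
by congr Qs5; rewrite /=; field.
Qed.
Fact invK0 : invK 0 = 0.
Proof. by rewrite /invK /= oppr0 !mul0r. Qed.

HB.instance Definition _ := GRing.ComNzRing_isField.Build Qsqrt5 mulVK invK0.

Definition conjK (x : Qsqrt5) : Qsqrt5 := Qs5 (ratpart x) (- s5part x).

Definition realK (R : realType) (x : Qsqrt5) : R :=
  ratr (ratpart x) + ratr (s5part x) * Num.sqrt 5.

Definition tau : Qsqrt5 := (1 + Qs5 0 1) / 2.

Definition golden_int : set Qsqrt5 :=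
  [set x | exists m n : int, x = m%:~R + n%:~R * tau].

(* A quaternion a + ib + jc + kd over F is the row vector (a, b, c, d), so that
   real quaternions are vectors of R^4. *)
Definition quat (F : Type) (a b c d : F) : 'rV[F]_4 :=
  \row_(i < 4) tnth [tuple a; b; c; d] i.

Definition qmul (F : comNzRingType) (p q : 'rV[F]_4) : 'rV[F]_4 :=
  let: (a1, b1, c1, d1) := (p 0 0, p 0 1, p 0 2, p 0 3) in
  let: (a2, b2, c2, d2) := (q 0 0, q 0 1, q 0 2, q 0 3) in
  quat (a1 * a2 - b1 * b2 - c1 * c2 - d1 * d2)
       (a1 * b2 + b1 * a2 + c1 * d2 - d1 * c2)
       (a1 * c2 - b1 * d2 + c1 * a2 + d1 * b2)
       (a1 * d2 + b1 * c2 - c1 * b2 + d1 * a2).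

(* The Euclidean length; the notation `|q| on matrices is a sup norm. *)
Definition qnorm (R : realType) (q : 'rV[R]_4) : R :=
  Num.sqrt (\sum_(i < 4) q 0 i ^+ 2).

Definition realH (R : realType) (q : 'rV[Qsqrt5]_4) : 'rV[R]_4 :=
  map_mx (@realK R) q.

Definition twist (q : 'rV[Qsqrt5]_4) : 'rV[Qsqrt5]_4 :=
  quat (conjK (q 0 0)) (conjK (q 0 1)) (conjK (q 0 3)) (conjK (q 0 2)).

Definition icosian_gens : 4.-tuple 'rV[Qsqrt5]_4 :=
  [tuple quat 1 0 0 0;
         quat 0 1 0 0;
         2^-1 *: quat 1 1 1 1;
         2^-1 *: quat (1 - tau) tau 0 1].

Definition icosian : set 'rV[Qsqrt5]_4 :=
  [set q | exists2 a : 'I_4 -> Qsqrt5,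
     forall i, golden_int (a i) &
     q = \sum_(i < 4) a i *: tnth icosian_gens i].

Definition A4_gens : 4.-tuple 'rV[Qsqrt5]_4 :=
  [tuple quat 1 0 0 0;
         2^-1 *: quat (-1) 1 1 1;
         quat 0 (-1) 0 0;
         2^-1 *: quat 0 1 (tau - 1) (- tau)].

Definition A4_lattice (R : realType) : set 'rV[R]_4 :=
  [set v | inIntSpan (map_tuple (@realH R) A4_gens) v].
Arguments A4_lattice R _ : clear implicits.

Definition primitive (q : 'rV[Qsqrt5]_4) : Prop :=
  forall alpha : Qsqrt5, icosian (alpha *: q) -> golden_int alpha.

Definition qtwist_norm (R : realType) (q : 'rV[Qsqrt5]_4) : R :=
  qnorm (realH R (qmul q (twist q))).

Definition admissible (R : realType) (q : 'rV[Qsqrt5]_4) : Prop :=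
  exists2 n : nat, (0 < n)%N & qtwist_norm R q = n%:R.

Definition full_rank_lattice (R : realType) (M : set 'rV[R]_4) : Prop :=
  exists2 s : 4.-tuple 'rV[R]_4,
    basis_of {:'rV[R]_4} s & M = [set v | inIntSpan s v].

Definition commensurate (R : realType) (M N : set 'rV[R]_4) : Prop :=
  exists P : set 'rV[R]_4,
    [/\ full_rank_lattice P, (P `<=` M) & (P `<=` N)].

(* Linear maps act on row vectors on the right: v |-> v *m A. *)
Definition isometry_image (R : realType) (A : 'M[R]_4) (M : set 'rV[R]_4) :
  set 'rV[R]_4 := [set v *m A | v in M].

Definition coincidence_isometry (R : realType) (A : 'M[R]_4) : Prop :=
  A *m A^T = 1%:M /\
  commensurate (A4_lattice R) (isometry_image A (A4_lattice R)).

Definition csl (R : realType) (A : 'M[R]_4) : set 'rV[R]_4 :=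
  (A4_lattice R `&` isometry_image A (A4_lattice R)).

Definition twisted_image (R : realType) (q : 'rV[Qsqrt5]_4) : set 'rV[R]_4 :=
  [set (qtwist_norm R q)^-1 *: qmul (qmul (realH R q) x) (realH R (twist q))
     | x in A4_lattice R].
Arguments twisted_image R q _ : clear implicits.

(* Main.v *)
(* L consists of vectors fixed by the twist, on whose span V over Q the
   Euclidean norm is rational.  The reflection of V in u is
   x |-> - u (conj x) u / |u|^2, and the twist is an anti-automorphism fixing u,
   so composing reflections only produces maps x |-> c q x (twist q) or
   x |-> c q (conj x) (twist q) with c rational.  By Cartan-Dieudonne every
   coincidence isometry has this form, and L = conj L removes the second case.
   Rescaling q by alpha in K multiplies c by the inverse of the norm of alpha, so
   q can be taken primitive in the icosians because Z[tau] is principal; the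
   isometry condition then reads |c| = 1 / |q (twist q)|, so |q (twist q)| is
   rational; its square is the norm of |q|^2 in Z[tau], so it is an integer. *)
Require Import Defs.
From HB Require Import structures.
From mathcomp Require Import all_boot all_order all_algebra ring lra.
From mathcomp Require Import boolp classical_sets reals.

Set Implicit Arguments.
Unset Strict Implicit.
Unset Printing Implicit Defensive.

Import Order.TTheory GRing.Theory Num.Theory.

Local Open Scope ring_scope.

(** * Coordinates in dimension four *)

Lemma row4P (F : Type) (x y : 'rV[F]_4) :
  x 0 0 = y 0 0 -> x 0 1 = y 0 1 -> x 0 2 = y 0 2 -> x 0 3 = y 0 3 -> x = y.
Proof.
move=> e0 e1 e2 e3; apply/rowP => i.
by case: i => [[|[|[|[|//]]]]] lt_i; [move: e0 | move: e1 | move: e2 | move: e3];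
  congr (x _ _ = y _ _); apply: val_inj.
Qed.

Lemma forall_ord4 (P : 'I_4 -> Prop) : P 0 -> P 1 -> P 2 -> P 3 -> forall i, P i.
Proof.
move=> p0 p1 p2 p3 i.
by case: i => [[|[|[|[|//]]]]] lt_i; [move: p0 | move: p1 | move: p2 | move: p3];
  congr P; apply: val_inj.
Qed.

Lemma sum_ord4 (V : nmodType) (f : 'I_4 -> V) :
  \sum_(i < 4) f i = f 0 + f 1 + f 2 + f 3.
Proof.
rewrite !big_ord_recr /= big_ord0 add0r.
by congr (f _ + f _ + f _ + f _); apply: val_inj.
Qed.

(** * Quaternions over a commutative ring *)

Section Quaternions.
Variable F : comNzRingType.
Implicit Types (a : F) (x y z p q : 'rV[F]_4).

(** Half of the trace form [x conj(y) + y conj(x)]. Working with [qdot x x] instead of its square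
    root keeps lengths inside the coefficient ring. *)
Definition qdot x y : F :=
  x 0 0 * y 0 0 + x 0 1 * y 0 1 + x 0 2 * y 0 2 + x 0 3 * y 0 3.
Definition qconj x : 'rV[F]_4 := quat (x 0 0) (- x 0 1) (- x 0 2) (- x 0 3).

Lemma quatE a b c d :
  (quat a b c d 0 0 = a :> F) * (quat a b c d 0 1 = b :> F) *
  (quat a b c d 0 2 = c :> F) * (quat a b c d 0 3 = d :> F).
Proof. by rewrite !mxE !(tnth_nth 0). Qed.

Lemma qmulA : associative (@qmul F).
Proof. by move=> x y z; apply: row4P; rewrite !quatE; ring. Qed.

Lemma qmulDr x y z : qmul x (y + z) = qmul x y + qmul x z.
Proof. by apply: row4P; rewrite !(quatE, mxE); ring. Qed.

Lemma qmulDl x y z : qmul (x + y) z = qmul x z + qmul y z.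
Proof. by apply: row4P; rewrite !(quatE, mxE); ring. Qed.

Lemma qmulZl a x y : qmul (a *: x) y = a *: qmul x y.
Proof. by apply: row4P; rewrite !(quatE, mxE); ring. Qed.

Lemma qmulZr a x y : qmul x (a *: y) = a *: qmul x y.
Proof. by apply: row4P; rewrite !(quatE, mxE); ring. Qed.

Lemma qmul1 x : qmul x (quat 1 0 0 0) = x.
Proof. by apply: row4P; rewrite !quatE; ring. Qed.

Lemma qconjK : involutive qconj.
Proof. by move=> x; apply: row4P; rewrite !quatE ?opprK. Qed.

Lemma qconjM x y : qconj (qmul x y) = qmul (qconj y) (qconj x).
Proof. by apply: row4P; rewrite !quatE; ring. Qed.

Lemma qconjD x y : qconj (x + y) = qconj x + qconj y.
Proof. by apply: row4P; rewrite !(quatE, mxE); ring. Qed.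

Lemma qconjZ a x : qconj (a *: x) = a *: qconj x.
Proof. by apply: row4P; rewrite !(quatE, mxE); ring. Qed.

(** The extra factor [y] lets the norm leave a longer product as a scalar, with no unit quaternion
    left behind. *)
Lemma qmul_conj x y : qmul (qmul x (qconj x)) y = qdot x x *: y.
Proof. by apply: row4P; rewrite !(quatE, mxE) /qdot; ring. Qed.

Lemma qmul_conj_r x y : qmul y (qmul (qconj x) x) = qdot x x *: y.
Proof. by apply: row4P; rewrite !(quatE, mxE) /qdot; ring. Qed.

(** Polarising the norm gives [u conj(x) + x conj(u) = 2 <x, u>]; multiply by [u] on the right. Up
    to the factor [- 1 / |u|^2] this is the usual reflection formula. *)
Lemma qmul_sandwich u x :
  qmul (qmul u (qconj x)) u = (2 * qdot x u) *: u - qdot u u *: x.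
Proof. by apply: row4P; rewrite !(quatE, mxE) /qdot; ring. Qed.

Lemma qdotMl p x y : qdot (qmul p x) (qmul p y) = qdot p p * qdot x y.
Proof. by rewrite /qdot !quatE; ring. Qed.

Lemma qdotMr p x y : qdot (qmul x p) (qmul y p) = qdot p p * qdot x y.
Proof. by rewrite /qdot !quatE; ring. Qed.

Lemma qdot_conj x y : qdot (qconj x) (qconj y) = qdot x y.
Proof. by rewrite /qdot !quatE; ring. Qed.

Lemma qdotZ a x y : qdot (a *: x) (a *: y) = a ^+ 2 * qdot x y.
Proof. by rewrite /qdot !mxE; ring. Qed.

Lemma qdotE x y : qdot x y = (x *m y^T) 0 0.
Proof. by rewrite !mxE sum_ord4 /qdot !mxE. Qed.

(** The Boolean treats the maps built from [x] and those built from its conjugate together; each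
    reflection flips it. *)
Definition qconj_if (f : bool) x := if f then qconj x else x.

Definition qtwo_sided p r x := qmul (qmul p x) r.

Fact qtwo_sided_is_linear p r : linear (qtwo_sided p r).
Proof. by move=> a x y; rewrite /qtwo_sided qmulDr qmulZr qmulDl qmulZl. Qed.
HB.instance Definition _ p r :=
  GRing.isLinear.Build F 'rV[F]_4 'rV[F]_4 _ (qtwo_sided p r)
    (qtwo_sided_is_linear p r).

Fact qconj_is_linear : linear qconj.
Proof. by move=> a x y; rewrite qconjD qconjZ. Qed.
HB.instance Definition _ :=
  GRing.isLinear.Build F 'rV[F]_4 'rV[F]_4 _ qconj qconj_is_linear.

Fact qconj_if_is_linear f : linear (qconj_if f).
Proof. by case: f => a x y; rewrite /= ?linearP. Qed.
HB.instance Definition _ f :=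
  GRing.isLinear.Build F 'rV[F]_4 'rV[F]_4 _ (qconj_if f) (qconj_if_is_linear f).

Lemma qconj_ifK f : involutive (qconj_if f).
Proof. by case: f => x //=; rewrite qconjK. Qed.

Lemma qconj_conj_if f x : qconj (qconj_if f x) = qconj_if (~~ f) x.
Proof. by case: f => //=; rewrite qconjK. Qed.

Lemma qdot_conj_if f x y : qdot (qconj_if f x) (qconj_if f y) = qdot x y.
Proof. by case: f => //=; rewrite qdot_conj. Qed.

Lemma qdot_two_sided p r x y :
  qdot (qtwo_sided p r x) (qtwo_sided p r y) = qdot p p * qdot r r * qdot x y.
Proof. by rewrite qdotMr qdotMl mulrCA mulrA. Qed.

End Quaternions.

Section QuaternionMorphism.
Variables (F E : comNzRingType) (f : {rmorphism F -> E}).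
Implicit Types x y : 'rV[F]_4.

Lemma map_qmul x y : map_mx f (qmul x y) = qmul (map_mx f x) (map_mx f y).
Proof.
by apply: row4P; rewrite mxE !quatE !mxE !(rmorphD, rmorphN, rmorphM).
Qed.

Lemma map_qconj x : map_mx f (qconj x) = qconj (map_mx f x).
Proof. by apply: row4P; rewrite mxE !quatE !mxE ?rmorphN. Qed.

Lemma map_qdot x y : qdot (map_mx f x) (map_mx f y) = f (qdot x y).
Proof. by rewrite /qdot !mxE !(rmorphD, rmorphM). Qed.

End QuaternionMorphism.

(** * The field K: conjugation, rational subfield, real embedding *)

Lemma conjK_is_zmod_morphism : zmod_morphism conjK.
Proof. by move=> [a b] [c d]; congr Qs5; rewrite /= opprD. Qed.
Lemma conjK_is_monoid_morphism : monoid_morphism conjK.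
Proof.
split; first by congr Qs5; rewrite /= oppr0.
by move=> [a b] [c d]; congr Qs5; rewrite /=; ring.
Qed.
HB.instance Definition _ :=
  GRing.isZmodMorphism.Build Qsqrt5 Qsqrt5 conjK conjK_is_zmod_morphism.
HB.instance Definition _ :=
  GRing.isMonoidMorphism.Build Qsqrt5 Qsqrt5 conjK conjK_is_monoid_morphism.

Lemma conjKK : involutive conjK.
Proof. by case=> a b; rewrite /conjK /= opprK. Qed.

Definition ratK (r : rat) : Qsqrt5 := Qs5 r 0.

Lemma ratK_is_zmod_morphism : zmod_morphism ratK.
Proof. by move=> a b; congr Qs5. Qed.
Lemma ratK_is_monoid_morphism : monoid_morphism ratK.
Proof.
by split=> [//|a b]; congr Qs5; rewrite /= !(mulr0, mul0r, addr0).
Qed.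
HB.instance Definition _ :=
  GRing.isZmodMorphism.Build rat Qsqrt5 ratK ratK_is_zmod_morphism.
HB.instance Definition _ :=
  GRing.isMonoidMorphism.Build rat Qsqrt5 ratK ratK_is_monoid_morphism.

Lemma conjK_rat r : conjK (ratK r) = ratK r.
Proof. by rewrite /conjK /= oppr0. Qed.

Lemma conjK_fixed x : conjK x = x -> x = ratK (ratpart x).
Proof.
case: x => a b [] /eqP; rewrite -subr_eq0 -opprD oppr_eq0 -mulr2n mulrn_eq0 /=.
by move=> /eqP ->.
Qed.

Lemma mulK_conj x : x * conjK x = ratK (fieldnormK x).
Proof. by case: x => a b; congr Qs5; rewrite /fieldnormK /=; ring. Qed.

Lemma fieldnormKM x y : fieldnormK (x * y) = fieldnormK x * fieldnormK y.
Proof. by case: x y => [a b] [c d]; rewrite /fieldnormK /=; ring. Qed.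

Lemma tau_pair : tau = Qs5 2^-1 2^-1.
Proof. by congr Qs5. Qed.
Lemma tau2 : tau * tau = tau + 1.
Proof. by rewrite tau_pair; congr Qs5. Qed.
Lemma two_neq0 : (2 : Qsqrt5) != 0.
Proof. by []. Qed.

Section RealEmbedding.
Variable R : realType.

Lemma realK_is_zmod_morphism : zmod_morphism (@realK R).
Proof. by move=> [a b] [c d]; rewrite /realK /= !rmorphB /=; ring. Qed.
Lemma realK_is_monoid_morphism : monoid_morphism (@realK R).
Proof.
split; first by rewrite /realK /= rmorph1 rmorph0 mul0r addr0.
move=> [a b] [c d]; rewrite /realK [ratpart _]/= [s5part _]/=.
rewrite (rmorphD _ (a * c)) (rmorphD _ (a * d)) (rmorphM _ 5) !rmorphM /=.
have -> : ratr (5 : rat) = 5 :> R by exact: ratr_nat.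
have e : Num.sqrt 5 * Num.sqrt 5 = 5 :> R by rewrite -expr2 sqr_sqrtr ?ler0n.
by ring: e.
Qed.
HB.instance Definition _ :=
  GRing.isZmodMorphism.Build Qsqrt5 R (@realK R) realK_is_zmod_morphism.
HB.instance Definition _ :=
  GRing.isMonoidMorphism.Build Qsqrt5 R (@realK R) realK_is_monoid_morphism.

Lemma realK_rat r : realK R (ratK r) = ratr r.
Proof. by rewrite /realK /= rmorph0 mul0r addr0. Qed.

Lemma realH_qmul x y : realH R (qmul x y) = qmul (realH R x) (realH R y).
Proof. exact: map_qmul. Qed.

Lemma realH_qconj x : realH R (qconj x) = qconj (realH R x).
Proof. exact: map_qconj. Qed.

Lemma realH_conj_if f x : realH R (qconj_if f x) = qconj_if f (realH R x).
Proof. by case: f; rewrite /= ?realH_qconj. Qed.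

Lemma realHZ a x : realH R (a *: x) = realK R a *: realH R x.
Proof. exact: map_mxZ. Qed.

Lemma realH_qdot x y : qdot (realH R x) (realH R y) = realK R (qdot x y).
Proof. exact: map_qdot. Qed.

Lemma qnorm_sqr (x : 'rV[R]_4) : qnorm x ^+ 2 = qdot x x.
Proof.
rewrite sqr_sqrtr; first by rewrite sum_ord4 /qdot -!expr2.
by apply: sumr_ge0 => i _; apply: sqr_ge0.
Qed.

End RealEmbedding.

(** * The twist map *)

(** Exchanging the j and k coordinates reverses the orientation of the imaginary space and hence the
    order of products, while conjugating coefficients is a ring automorphism. *)
Lemma twistM x y : twist (qmul x y) = qmul (twist y) (twist x).
Proof.
apply: row4P; rewrite !quatE !(rmorphD, rmorphN, rmorphM) /=; ring.
Qed.

Lemma twistK : involutive twist.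
Proof. by move=> x; apply: row4P; rewrite !quatE conjKK. Qed.

Lemma twistZ a x : twist (a *: x) = conjK a *: twist x.
Proof. by apply: row4P; rewrite !(quatE, mxE) rmorphM. Qed.

Lemma twistD x y : twist (x + y) = twist x + twist y.
Proof. by apply: row4P; rewrite !(quatE, mxE) rmorphD. Qed.

Lemma twist_conj x : twist (qconj x) = qconj (twist x).
Proof. by apply: row4P; rewrite !quatE ?rmorphN. Qed.

Lemma qdot_twist x y : qdot (twist x) (twist y) = conjK (qdot x y).
Proof. by rewrite /qdot !quatE !(rmorphD, rmorphM) /=; ring. Qed.

Lemma two_sided_twist q x :
  twist x = x -> twist (qtwo_sided q (twist q) x) = qtwo_sided q (twist q) x.
Proof. by move=> tx; rewrite /qtwo_sided !twistM twistK tx qmulA. Qed.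

Lemma qdot_twist_fixed x :
  twist x = x -> qdot x x = ratK (ratpart (qdot x x)).
Proof. by move=> tx; apply: conjK_fixed; rewrite -qdot_twist tx. Qed.

(** The rational part of [(a + b sqrt 5)^2] is [a^2 + 5 b^2], which is nonnegative and vanishes only
    at 0. So the rational part of a sum of four squares already forces every coordinate to be 0. *)
Lemma qdot_eq0 (x : 'rV[Qsqrt5]_4) : qdot x x = 0 -> x = 0.
Proof.
have sq_ge0 (y : Qsqrt5) : 0 <= ratpart (y * y) by case: y => a b /=; nra.
have sq_eq0 (y : Qsqrt5) : ratpart (y * y) == 0 -> y = 0.
  case: y => a b /= /eqP h.
  have a0 : a = 0 by nra.
  have b0 : b = 0 by nra.
  by rewrite a0 b0.
have ratpartD (y z : Qsqrt5) : ratpart (y + z) = ratpart y + ratpart z by [].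
have add_eq0 (a b c d : rat) : 0 <= a -> 0 <= b -> 0 <= c -> 0 <= d ->
    a + b + c + d = 0 -> [/\ a = 0, b = 0, c = 0 & d = 0].
  by move=> a0 b0 c0 d0 e; split; lra.
move=> /(congr1 ratpart); rewrite /qdot !ratpartD.
case/add_eq0 => // /eqP/sq_eq0 e0 /eqP/sq_eq0 e1 /eqP/sq_eq0 e2 /eqP/sq_eq0 e3.
by apply: row4P; rewrite mxE.
Qed.

(** * Reflections and the form of twist-compatible isometries *)

Definition reflect_in (u x : 'rV[Qsqrt5]_4) :=
  - (qdot u u)^-1 *: qmul (qmul u (qconj x)) u.

Section Reflection.
Variable u : 'rV[Qsqrt5]_4.
Hypothesis u0 : u != 0.
Implicit Types x y : 'rV[Qsqrt5]_4.

Lemma qdot_neq0 : qdot u u != 0.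
Proof. by apply: contra u0 => /eqP /qdot_eq0 ->. Qed.

Lemma reflect_inK : involutive (reflect_in u).
Proof.
move=> x; rewrite /reflect_in qconjZ qmulZr qmulZl scalerA !qconjM qconjK.
rewrite !qmulA qmul_conj -!qmulA qmul_conj_r !scalerA.
rewrite [X in X *: _](_ : _ = 1) ?scale1r //.
by field; exact: qdot_neq0.
Qed.

Lemma qdot_reflect x y : qdot (reflect_in u x) (reflect_in u y) = qdot x y.
Proof.
by rewrite qdotZ qdotMr qdotMl qdot_conj; field; exact: qdot_neq0.
Qed.

Lemma reflect_in_twist x :
  twist u = u -> twist x = x -> twist (reflect_in u x) = reflect_in u x.
Proof.
move=> tu tx; rewrite /reflect_in twistZ !twistM twist_conj tu tx qmulA.
by rewrite (qdot_twist_fixed tu) rmorphN fmorphV /= conjK_rat.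
Qed.

Lemma reflect_in_orth x : qdot x u = 0 -> reflect_in u x = x.
Proof.
move=> xu; rewrite /reflect_in qmul_sandwich xu mulr0 scale0r sub0r scaleNr.
by rewrite scalerN opprK scalerA mulVf ?qdot_neq0 // scale1r.
Qed.

End Reflection.

(** Equal lengths give [2 <v, v - b> = |v - b|^2], so reflecting [v] in [v - b] subtracts exactly
    [v - b]. *)
Lemma reflect_in_sub v b :
  qdot v v = qdot b b -> v != b -> reflect_in (v - b) v = b.
Proof.
move=> vb neq; have u0 : v - b != 0 by rewrite subr_eq0.
rewrite /reflect_in qmul_sandwich.
have -> : 2 * qdot v (v - b) = qdot (v - b) (v - b).
  apply/eqP; rewrite -subr_eq0; apply/eqP.
  transitivity (qdot v v - qdot b b); last by rewrite vb subrr.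
  by rewrite /qdot !mxE; ring.
rewrite -scalerBr scalerA mulNr mulVf ?qdot_neq0 // scaleN1r opprB.
exact: subKr.
Qed.

(** Only the values [v] on the vectors [b] are recorded, since a coincidence isometry is lifted to K
    through the images of the generators. *)
Definition twisted_similarity (b v : 4.-tuple 'rV[Qsqrt5]_4)
    (c : rat) (q : 'rV[Qsqrt5]_4) (f : bool) : Prop :=
  forall i, tnth v i = ratK c *: qtwo_sided q (twist q) (qconj_if f (tnth b i)).

(* Cartan-Dieudonne: composing with the reflection in v_k - b_k makes the
   isometry fix one more of the b_i. *)
Lemma twisted_similarity_isometry (b v : 4.-tuple 'rV[Qsqrt5]_4) :
  (forall i, twist (tnth b i) = tnth b i) ->
  (forall i, twist (tnth v i) = tnth v i) ->
  (forall i j, qdot (tnth v i) (tnth v j) = qdot (tnth b i) (tnth b j)) ->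
  exists c q f, twisted_similarity b v c q f.
Proof.
move=> tb.
(* The first [k] vectors already agree; the induction is on the number [m] of those left. *)
suff main m (k : nat) : (k + m = 4)%N ->
    (forall i : 'I_4, (i < k)%N -> tnth v i = tnth b i) ->
    (forall i, twist (tnth v i) = tnth v i) ->
    (forall i j, qdot (tnth v i) (tnth v j) = qdot (tnth b i) (tnth b j)) ->
    exists c q f, twisted_similarity b v c q f.
  by apply: (main 4 0).
elim: m k v => [|m IH] k v.
  rewrite addn0 => -> vb _ _; exists 1, (quat 1 0 0 0), false => i.
  have -> : twist (quat 1 0 0 0) = quat 1 0 0 0.
    by apply: row4P; rewrite !quatE ?rmorph0 ?rmorph1.
  rewrite vb // /qtwo_sided qmul1 rmorph1 scale1r.
  by apply: row4P; rewrite !quatE; ring.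
move=> km vb tv dv.
have lk : (k < 4)%N by rewrite -km -ltn_subLR // subnn.
pose K := Ordinal lk.
have km' : (k.+1 + m = 4)%N by rewrite -km addSnnS.
have [vK|vK] := eqVneq (tnth v K) (tnth b K).
  apply: (IH k.+1) => // i; rewrite ltnS leq_eqVlt => /orP[/eqP ik|].
    by have -> : i = K by apply: val_inj.
  exact: vb.
set u := tnth v K - tnth b K.
have u0 : u != 0 by rewrite subr_eq0.
have tu : twist u = u.
  by rewrite /u -scaleN1r twistD twistZ rmorphN1 tb tv.
pose w := [tuple reflect_in u (tnth v i) | i < 4].
have wE i : tnth w i = reflect_in u (tnth v i) by rewrite tnth_mktuple.
have [|i|i j|c [q [f cq]]] := IH k.+1 w km'.
- move=> i; rewrite ltnS leq_eqVlt wE => /orP[/eqP ik|ik].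
    by have -> : i = K by [apply: val_inj]; apply: reflect_in_sub; rewrite // dv.
  (* A vector [b_i] fixed earlier is orthogonal to [u]: since [v_i = b_i], its product with
     [v_K - b_K] is [<v_i, v_K> - <b_i, b_K> = 0]. *)
  rewrite reflect_in_orth ?vb //.
  transitivity (qdot (tnth v i) (tnth v K) - qdot (tnth b i) (tnth b K)).
    by rewrite (vb i ik) /qdot !mxE; ring.
  by rewrite dv subrr.
- by rewrite wE reflect_in_twist.
- by rewrite !wE qdot_reflect // dv.
have vE i : tnth v i = reflect_in u (tnth w i) by rewrite wE reflect_inK.
(* Reflecting [c q x (twist q)] in [u] gives [- c / |u|^2] times
   [u conj(twist q) conj(x) conj(q) u], and [conj(q) u] is the twist of [u conj(twist q)] because
   [u] is fixed by the twist. *)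
exists (- (ratpart (qdot u u))^-1 * c), (qmul u (qconj (twist q))), (~~ f) => i.
rewrite vE cq -qconj_conj_if; move: (qconj_if f _) => x.
rewrite /reflect_in /qtwo_sided qconjZ qmulZr qmulZl scalerA {1}(qdot_twist_fixed tu).
rewrite rmorphM rmorphN fmorphV; congr (_ *: _).
by rewrite !qconjM twistM twist_conj twistK tu !qmulA.
Qed.

(** * Arithmetic of Z[tau] and of the icosians *)

Lemma golden_intZ (m : int) : golden_int m%:~R.
Proof. by exists m, 0; rewrite mul0r addr0. Qed.

Lemma golden_nat (n : nat) : golden_int n%:R.
Proof. exact: (golden_intZ n). Qed.

Lemma golden_tau : golden_int tau.
Proof. by exists 0, 1; rewrite add0r mul1r. Qed.

Lemma goldenD x y : golden_int x -> golden_int y -> golden_int (x + y).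
Proof.
move=> [m [n ->]] [k [l ->]]; exists (m + k), (n + l).
by rewrite !rmorphD /= mulrDl addrACA.
Qed.

Lemma goldenM x y : golden_int x -> golden_int y -> golden_int (x * y).
Proof.
move=> [m [n ->]] [k [l ->]].
exists (m * k + n * l), (m * l + n * k + n * l).
by rewrite !(rmorphD, rmorphM) /=; ring: tau2.
Qed.

Lemma goldenN x : golden_int x -> golden_int (- x).
Proof. by rewrite -mulN1r => /(goldenM (golden_intZ (-1))). Qed.

Lemma goldenB x y : golden_int x -> golden_int y -> golden_int (x - y).
Proof. by move=> gx /goldenN; apply: goldenD. Qed.

Ltac golden := repeat lazymatch goal with
  | H : golden_int ?x |- golden_int ?x => exact: H
  | |- golden_int (_ - _) => apply: goldenB
  | |- golden_int (_ + _) => apply: goldenD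
  | |- golden_int (_ * _) => apply: goldenM
  | |- _ => done
  end.

Lemma fieldnormK_golden (s t : rat) :
  fieldnormK (ratK s + ratK t * tau) = s ^+ 2 + s * t - t ^+ 2.
Proof. by rewrite tau_pair /fieldnormK /=; field. Qed.

Lemma ratK_int (m : int) : ratK m%:~R = m%:~R.
Proof. exact: rmorph_int. Qed.

Lemma golden_norm_int x : golden_int x -> exists m : int, fieldnormK x = m%:~R.
Proof.
move=> [m [n ->]]; exists (m ^+ 2 + m * n - n ^+ 2).
by rewrite -!ratK_int fieldnormK_golden !(rmorphD, rmorphM, rmorphN).
Qed.

Lemma round_rat (u : rat) : exists m : int, - 2^-1 <= u - m%:~R <= 2^-1.
Proof.
exists (Num.floor (u + 2^-1)).
have := floor_le (u + 2^-1); have := floorD1_gt (u + 2^-1).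
rewrite rmorphD /= => h1 h2; apply/andP; split; lra.
Qed.

(** In the basis 1, tau, the element [a + b sqrt 5] has coordinates [a - b] and [2 b]. Rounding both
    leaves remainders [s], [t] of size at most 1/2, so [|s^2 + s t - t^2| <= 3/4]. *)
Lemma golden_euclid x :
  exists2 g, golden_int g & `|fieldnormK (x - g)| < 1.
Proof.
case: x => a b.
have [m /andP[m1 m2]] := round_rat (a - b).
have [n /andP[n1 n2]] := round_rat (2 * b).
exists (m%:~R + n%:~R * tau); first by exists m, n.
have -> : Qs5 a b - (m%:~R + n%:~R * tau) =
    ratK (a - b - m%:~R) + ratK (2 * b - n%:~R) * tau.
  by rewrite -!ratK_int tau_pair; congr Qs5; rewrite /=; field.
rewrite fieldnormK_golden; move: (a - b - _) m1 m2 => s s1 s2.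
move: (2 * b - _) n1 n2 => t t1 t2.
by rewrite ltr_norml; apply/andP; split; nra.
Qed.

Lemma icosianP q : icosian q <->
  exists a b c d : Qsqrt5,
    [/\ golden_int a, golden_int b, golden_int c, golden_int d &
        q = a *: quat 1 0 0 0 + b *: quat 0 1 0 0 + c *: (2^-1 *: quat 1 1 1 1)
              + d *: (2^-1 *: quat (1 - tau) tau 0 1)].
Proof.
split=> [[a ga ->]|[a [b [c [d [ga gb gc gd ->]]]]]].
  by exists (a 0), (a 1), (a 2), (a 3); split; rewrite // sum_ord4 !(tnth_nth 0).
exists (tnth [tuple a; b; c; d]); last by rewrite sum_ord4 !(tnth_nth 0).
by apply: forall_ord4; rewrite (tnth_nth 0).
Qed.

Lemma icosianD p q : icosian p -> icosian q -> icosian (p + q).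
Proof.
move=> [a ga ->] [b gb ->]; exists (fun i => a i + b i).
  by move=> i; apply: goldenD.
by rewrite -big_split; apply: eq_bigr => i _; rewrite scalerDl.
Qed.

Lemma icosianZ g q : golden_int g -> icosian q -> icosian (g *: q).
Proof.
move=> gg [a ga ->]; exists (fun i => g * a i).
  by move=> i; apply: goldenM.
by rewrite scaler_sumr; apply: eq_bigr => i _; rewrite scalerA.
Qed.

Lemma icosian_golden (q : 'rV[Qsqrt5]_4) :
  (forall i, golden_int (q 0 i)) -> icosian q.
Proof.
move=> gq; apply/icosianP.
have g1 : golden_int 1 := golden_nat 1; have g2 := golden_nat 2.
have gt := golden_tau.
have n2 := two_neq0.
(* With coefficients [a], [b], [c], [d] on the generators, the last two coordinates are [c / 2] and
   [(c + d) / 2]; these determine [c] and [d], and then the first two coordinates give [a] and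
   [b]. *)
exists (q 0 0 - q 0 2 - (q 0 3 - q 0 2) * (1 - tau)).
exists (q 0 1 - q 0 2 - (q 0 3 - q 0 2) * tau).
exists (2 * q 0 2), (2 * (q 0 3 - q 0 2)); split.
1-4: by golden.
by apply: row4P; rewrite !(quatE, mxE); field.
Qed.

Lemma golden_double_icosian (q : 'rV[Qsqrt5]_4) i :
  icosian q -> golden_int (2 * q 0 i).
Proof.
case/icosianP=> a [b [c [d [ga gb gc gd ->]]]]; move: i.
have g1 : golden_int 1 := golden_nat 1; have g2 := golden_nat 2.
have gt := golden_tau.
have n2 := two_neq0.
apply: forall_ord4; rewrite !(quatE, mxE).
- rewrite (_ : _ * _ = 2 * a + c + d * (1 - tau)); last by field.
  by golden.
- rewrite (_ : _ * _ = 2 * b + c + d * tau); last by field.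
  by golden.
- by rewrite (_ : _ * _ = c); last by field.
- rewrite (_ : _ * _ = c + d); last by field.
  by golden.
Qed.

(** The generators have norm 1, and twice their mutual inner products are 0, 1, [tau] or [1 - tau];
    so the norm form has coefficients in Z[tau]. *)
Lemma golden_qdot_icosian q : icosian q -> golden_int (qdot q q).
Proof.
case/icosianP=> a [b [c [d [ga gb gc gd ->]]]].
have g1 : golden_int 1 := golden_nat 1; have gt := golden_tau.
have n2 := two_neq0.
rewrite (_ : qdot _ _ = a * a + b * b + c * c + d * d + a * c
   + (1 - tau) * (a * d) + b * c + tau * (b * d) + c * d).
  by golden.
rewrite !scalerA; move: (c / 2) (d / 2) (divfK n2 c) (divfK n2 d) => c' d' <- <-.
by rewrite /qdot !(quatE, mxE); ring: tau2.
Qed.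

Lemma golden_multiple x : exists2 n : int, n != 0 & golden_int (n%:~R * x).
Proof.
case: x => a b; exists (denq a * denq b); first by rewrite mulf_neq0 ?denq_eq0.
exists (numq a * denq b - numq b * denq a), (2 * (numq b * denq a)).
rewrite -!ratK_int !(rmorphB, rmorphM) /= !ratK_int -!ratK_int !numqE.
by rewrite tau_pair; congr Qs5; rewrite /=; field.
Qed.

Lemma icosian_multiple q : exists2 n : int, n != 0 & icosian (n%:~R *: q).
Proof.
have [n0 z0 g0] := golden_multiple (q 0 0).
have [n1 z1 g1] := golden_multiple (q 0 1).
have [n2 z2 g2] := golden_multiple (q 0 2).
have [n3 z3 g3] := golden_multiple (q 0 3).
exists (n0 * n1 * n2 * n3); first by rewrite !mulf_neq0.
have i0 := golden_intZ n0; have i1 := golden_intZ n1.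
have i2 := golden_intZ n2; have i3 := golden_intZ n3.
apply: icosian_golden; apply: forall_ord4; rewrite mxE !rmorphM /=.
- rewrite (_ : _ * _ = n1%:~R * n2%:~R * n3%:~R * (n0%:~R * q 0 0)); last by ring.
  by golden.
- rewrite (_ : _ * _ = n0%:~R * n2%:~R * n3%:~R * (n1%:~R * q 0 1)); last by ring.
  by golden.
- rewrite (_ : _ * _ = n0%:~R * n1%:~R * n3%:~R * (n2%:~R * q 0 2)); last by ring.
  by golden.
- by rewrite -mulrA; golden.
Qed.

(* {alpha | alpha q in I} is a fractional ideal of the norm-Euclidean ring
   Z[tau]; an element of least norm generates it. *)
Lemma primitive_multiple (q : 'rV[Qsqrt5]_4) : q != 0 ->
  exists a : Qsqrt5, [/\ a != 0, icosian (a *: q) & primitive (a *: q)].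
Proof.
move=> q0.
have [i qi0] : exists i, q 0 i != 0.
  apply/existsP; apply: contraR q0 => /existsPn h; apply/eqP/rowP => j.
  by rewrite mxE; apply/eqP/negPn/h.
(* A nonzero coordinate measures the size of [a]; the factor 2 clears the halves of the icosians, so
   that [N] takes natural values on the ideal. *)
pose N (a : Qsqrt5) : rat := `|fieldnormK (2 * (a *: q) 0 i)|.
have NE a : icosian (a *: q) -> exists n : nat, N a = n%:R.
  move=> /(golden_double_icosian i)/golden_norm_int[m e].
  by exists `|m|%N; rewrite /N e natr_absz intr_norm.
have NM a b : N (a * b) = `|fieldnormK a| * N b.
  by rewrite /N !mxE -normrM -fieldnormKM; congr `|fieldnormK _|; ring.
pose P n := `[< exists a : Qsqrt5, [/\ a != 0, icosian (a *: q) & N a = n%:R] >].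
have exP : exists n, P n.
  have [n n0 In] := icosian_multiple q; have [k Nk] := NE _ In.
  exists k; apply/asboolP; exists n%:~R; split=> //.
  by rewrite -ratK_int fmorph_eq0 intr_eq0.
case: (ex_minnP exP) => k /asboolP[a [a0 Ia Na]] mink.
exists a; split=> // b; rewrite scalerA => Iba.
(* Division with remainder: were [b - g] nonzero, [(b - g) a] would lie in the ideal with a smaller
   [N] than [a]. *)
have [g gg small] := golden_euclid b.
have [/eqP|ne] := eqVneq (b - g) 0; first by rewrite subr_eq0 => /eqP ->.
have Ir : icosian (((b - g) * a) *: q).
  have := icosianD Iba (icosianZ (goldenN gg) Ia).
  by rewrite scalerA -scalerDl -mulrDl.
have [l Nl] := NE _ Ir.
have /mink : P l by apply/asboolP; exists ((b - g) * a); rewrite mulf_neq0.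
rewrite -(ler_nat rat) -Nl -Na NM leNgt gtr_pMl ?small //.
rewrite /N normr_gt0 mxE.
by apply: contra (mulf_neq0 two_neq0 (mulf_neq0 a0 qi0)) => /eqP/fieldnormK_eq0 ->.
Qed.

(** The square of the denominator divides that of the numerator, so the denominator divides the
    numerator, and coprimality makes it 1. *)
Lemma rat_sqrt_int (r : rat) : 0 <= r -> r ^+ 2 \is a Num.int ->
  exists n : nat, r = n%:R.
Proof.
move=> r0 /intrP[m e].
have : (numq r) ^+ 2 = m * (denq r) ^+ 2.
  by apply: (@intr_inj rat); rewrite rmorphXn rmorphM rmorphXn /= numqE exprMn e.
move=> /(congr1 absz); rewrite abszM !abszX => h.
have : (`|denq r| ^ 2 %| `|numq r| ^ 2)%N by rewrite h dvdn_mull.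
rewrite dvdn_pexp2r // => dvd.
have : (gcdn `|numq r| `|denq r| == 1)%N by exact: coprime_num_den.
move/gcdn_idPr: dvd => -> /eqP d1.
exists `|numq r|%N; rewrite natr_absz ger0_norm ?numq_ge0 //.
rewrite numqE -[denq r]gez0_abs ?d1 ?mulr1 //; exact: ltW (denq_gt0 r).
Qed.

(** * The lattice L and its rational span *)

Lemma A4_genE :
  (tnth A4_gens 0 = quat 1 0 0 0) * (tnth A4_gens 1 = 2^-1 *: quat (-1) 1 1 1) *
  (tnth A4_gens 2 = quat 0 (-1) 0 0) *
  (tnth A4_gens 3 = 2^-1 *: quat 0 1 (tau - 1) (- tau)).
Proof. by rewrite !(tnth_nth 0). Qed.

Lemma twist_A4_gens i : twist (tnth A4_gens i) = tnth A4_gens i.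
Proof.
have h2 : conjK 2^-1 = 2^-1 by rewrite fmorphV rmorph_nat.
have hN1 : conjK (-1) = -1 by rewrite rmorphN1.
have ht : conjK (tau - 1) = - tau by rewrite tau_pair; congr Qs5.
have htN : conjK (- tau) = tau - 1 by rewrite tau_pair; congr Qs5.
move: i; apply: forall_ord4; rewrite !A4_genE ?twistZ ?h2; try congr (_ *: _).
all: by apply: row4P; rewrite !quatE ?(hN1, ht, htN, rmorph0, rmorph1).
Qed.

Lemma twist_sum (k : 'I_4 -> rat) (b : 'I_4 -> 'rV[Qsqrt5]_4) :
  (forall i, twist (b i) = b i) ->
  twist (\sum_(i < 4) ratK (k i) *: b i) = \sum_(i < 4) ratK (k i) *: b i.
Proof. by move=> tb; rewrite !sum_ord4 !twistD !twistZ !conjK_rat !tb. Qed.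

(** A quaternion fixed by the twist has the form [(a, b, c + d sqrt 5, c - d sqrt 5)] with four
    rational parameters, as many as L has generators. *)
Lemma twist_fixed_span x : twist x = x ->
  exists k : 'I_4 -> rat, x = \sum_(i < 4) ratK (k i) *: tnth A4_gens i.
Proof.
move=> tx.
have := congr1 (fun y : 'rV_4 => y 0 0) tx; rewrite quatE => /conjK_fixed x0.
have := congr1 (fun y : 'rV_4 => y 0 1) tx; rewrite quatE => /conjK_fixed x1.
have := congr1 (fun y : 'rV_4 => y 0 3) tx; rewrite quatE => x3.
move: x0 x1 x3; move: (ratpart (x 0 0)) (ratpart (x 0 1)) => a b x0 x1.
case x2: (x 0 2) => [c d] x3.
(* The irrational part of the third coordinate gives the last coefficient, its rational part the
   second one; the first two coordinates then give the other two. *)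
exists (tnth [tuple a + c + d; 2 * (c + d); c + 3 * d - b; 4 * d]).
have h2 : 2^-1 = Qs5 2^-1 0 by congr Qs5.
rewrite sum_ord4 !(tnth_nth 0) /= tau_pair h2.
by apply: row4P; rewrite !(quatE, mxE) ?x0 ?x1 ?x2 -?x3; congr Qs5; rewrite /=; field.
Qed.

Section Lattice.
Variable R : realType.
Local Notation L := (A4_lattice R).
Local Notation b i := (realH R (tnth A4_gens i)).

Lemma inIntSpanP (n : nat) (s : n.-tuple 'rV[R]_4) v :
  inIntSpan s v <->
  exists a : 'I_n -> int, v = \sum_(i < n) (a i)%:~R *: tnth s i.
Proof.
split=> [[a ->]|[a ->]].
  by exists a; apply: eq_bigr => i _; rewrite scaler_int (tnth_nth 0).
by exists [ffun i => a i]; apply: eq_bigr => i _; rewrite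
  scaler_int (tnth_nth 0) ffunE.
Qed.

Lemma inIntSpan_gen (n : nat) (s : n.-tuple 'rV[R]_4) i : inIntSpan s (tnth s i).
Proof.
apply/inIntSpanP; exists (fun j => (j == i)%:R); rewrite (bigD1 i) //= eqxx scale1r.
by rewrite big1 ?addr0 // => j /negPf ->; rewrite scale0r.
Qed.

Lemma A4P v : L v <-> exists a : 'I_4 -> int, v = \sum_(i < 4) (a i)%:~R *: b i.
Proof.
split=> [/inIntSpanP[a ->]|[a ->]]; last apply/inIntSpanP; exists a;
  by apply: eq_bigr => i _; rewrite tnth_map.
Qed.

Lemma A4_sum (a : 'I_4 -> int) (x : 'I_4 -> 'rV[R]_4) :
  (forall i, L (x i)) -> L (\sum_(i < 4) (a i)%:~R *: x i).
Proof.
move=> Lx.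
have /fin_all_exists[c xE] i := (A4P (x i)).1 (Lx i); apply/A4P.
exists (fun j => \sum_(i < 4) a i * c i j).
under eq_bigr => i _ do rewrite xE scaler_sumr.
rewrite exchange_big; apply: eq_bigr => j _.
rewrite rmorph_sum scaler_suml; apply: eq_bigr => i _.
by rewrite scalerA rmorphM.
Qed.

Lemma A4Z (m : int) v : L v -> L (m%:~R *: v).
Proof.
move=> /A4P[a ->]; apply/A4P; exists (fun i => m * a i).
by rewrite scaler_sumr; apply: eq_bigr => i _; rewrite scalerA rmorphM.
Qed.

Lemma realH_sum (k : 'I_4 -> Qsqrt5) (x : 'I_4 -> 'rV[Qsqrt5]_4) :
  realH R (\sum_(i < 4) k i *: x i) = \sum_(i < 4) realK R (k i) *: realH R (x i).
Proof. by rewrite !sum_ord4 -!realHZ /realH !map_mxD. Qed.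

Lemma A4_realH (a : 'I_4 -> int) :
  L (realH R (\sum_(i < 4) (a i)%:~R *: tnth A4_gens i)).
Proof.
apply/A4P; exists a; rewrite realH_sum; apply: eq_bigr => i _.
by rewrite rmorph_int.
Qed.

(** Conjugation fixes the first generator, negates the last two, and sends the second to minus the
    sum of the first two. *)
Lemma A4_conj v : L v -> L (qconj v).
Proof.
move=> /A4P[a ->]; rewrite linear_sum /=.
under eq_bigr => i _ do rewrite linearZ /= -realH_qconj.
apply: A4_sum; clear a.
have gen (a0 a1 a2 a3 : int) x :
    x = a0%:~R *: tnth A4_gens 0 + a1%:~R *: tnth A4_gens 1 +
        a2%:~R *: tnth A4_gens 2 + a3%:~R *: tnth A4_gens 3 -> L (realH R x).
  move=> ->; have := A4_realH (tnth [tuple a0; a1; a2; a3]).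
  by rewrite sum_ord4 !(tnth_nth 0).
have n2 := two_neq0.
apply: forall_ord4.
- by apply: (gen 1 0 0 0); apply: row4P; rewrite !A4_genE !(quatE, mxE); field.
- by apply: (gen (-1) (-1) 0 0); apply: row4P; rewrite !A4_genE !(quatE, mxE); field.
- by apply: (gen 0 0 (-1) 0); apply: row4P; rewrite !A4_genE !(quatE, mxE); field.
- by apply: (gen 0 0 0 (-1)); apply: row4P; rewrite !A4_genE !(quatE, mxE); field.
Qed.

Lemma A4_multiple x : twist x = x ->
  exists2 n : int, n != 0 & L (n%:~R *: realH R x).
Proof.
move=> /twist_fixed_span[k ->].
pose n := \prod_i denq (k i).
have n0 : n != 0 by apply/prodf_neq0 => i _; rewrite denq_eq0.
exists n => //; apply/A4P.
exists (fun i => numq (k i) * \prod_(j < 4 | j != i) denq (k j)).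
rewrite realH_sum scaler_sumr; apply: eq_bigr => i _.
rewrite scalerA realK_rat /n (bigD1 i) //= !rmorphM /=; congr (_ *: _).
rewrite -!(ratr_int R) numqE rmorphM /=; ring.
Qed.

Lemma basis_ofP (s : 4.-tuple 'rV[R]_4) :
  basis_of {:'rV[R]_4} s <-> (\matrix_i tnth s i) \in unitmx.
Proof.
have sumE (k : 'rV[R]_4) : k *m (\matrix_i tnth s i) = \sum_(i < 4) k 0 i *: s`_i.
  by rewrite mulmx_sum_row; apply: eq_bigr => i _; rewrite rowK (tnth_nth 0).
rewrite basisEfree subvf dimvf /dim /= size_tuple leqnn andbT.
rewrite -row_free_unit; split=> [/freeP fs|/row_free_inj fs].
  apply: inj_row_free => v; rewrite sumE => /fs v0.
  by apply/rowP => i; rewrite v0 mxE.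
apply/freeP => k k0 i.
have : \row_i k i = 0.
  apply: fs; rewrite mul0mx sumE -[RHS]k0.
  by apply: eq_bigr => j _; rewrite mxE.
by move/rowP/(_ i); rewrite !mxE.
Qed.

Lemma A4_matrix_unit : (\matrix_i b i) \in unitmx.
Proof.
(* Invertibility may be tested over K, where a vanishing combination is solved for its coefficients
   one by one. *)
have -> : (\matrix_i b i) = map_mx (@realK R) (\matrix_i tnth A4_gens i).
  by apply/matrixP => i j; rewrite !mxE.
rewrite map_unitmx -row_free_unit; apply: inj_row_free => v.
rewrite mulmx_sum_row sum_ord4 !rowK => /rowP vA.
pose e k := v 0 0 * tnth A4_gens 0 0 k + v 0 1 * tnth A4_gens 1 0 k +
            v 0 2 * tnth A4_gens 2 0 k + v 0 3 * tnth A4_gens 3 0 k.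
have e0 k : e k = 0.
  have := vA k; rewrite /e; move: (tnth A4_gens 0) (tnth A4_gens 1).
  by move: (tnth A4_gens 2) (tnth A4_gens 3) => g2 g3 g0 g1; rewrite !mxE.
have n2 := two_neq0.
have v3 : v 0 3 = 0.
  (* This number is [sqrt 5], the factor of [v 0 3] in twice the difference of the last two
     coordinates. *)
  have s0 : 2 * tau - 1 != 0 by [].
  apply: (mulIf s0); rewrite mul0r; transitivity (2 * (e 2 - e 3)).
    by rewrite /e !A4_genE !(quatE, mxE); field.
  by rewrite !e0 subrr mulr0.
have v1 : v 0 1 = 0.
  transitivity (2 * e 3 + v 0 3 * tau); last by rewrite e0 v3 mulr0 mul0r addr0.
  by rewrite /e !A4_genE !(quatE, mxE); field.
have v0 : v 0 0 = 0.
  transitivity (e 0 + v 0 1 / 2); last by rewrite e0 v1 mul0r addr0.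
  by rewrite /e !A4_genE !(quatE, mxE); field.
have v2 : v 0 2 = 0.
  transitivity (v 0 1 / 2 + v 0 3 / 2 - e 1); last first.
    by rewrite e0 v1 v3 mul0r addr0 subr0.
  by rewrite /e !A4_genE !(quatE, mxE); field.
by apply: row4P; rewrite mxE.
Qed.

Lemma qtwist_norm_sqr q :
  qtwist_norm R q ^+ 2 = ratr (fieldnormK (qdot q q)).
Proof.
by rewrite qnorm_sqr realH_qdot qdotMl qdot_twist mulK_conj realK_rat.
Qed.

Lemma isometry_qdot (A : 'M[R]_4) :
  A *m A^T = 1%:M <-> forall x y, qdot (x *m A) (y *m A) = qdot x y.
Proof.
split=> [AA x y|iso].
  by rewrite !qdotE trmx_mul mulmxA -[x *m A *m _]mulmxA AA mulmx1.
apply/matrixP => i j.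
transitivity (qdot (delta_mx 0 i *m A) (delta_mx 0 j *m A)).
  by rewrite -!rowE /qdot mxE sum_ord4 !mxE.
rewrite iso qdotE trmx_delta mul_delta_mx_cond [RHS]mxE.
by case: (i == j); rewrite ?mulr1n ?mulr0n mxE ?eqxx.
Qed.

End Lattice.

(** * Coincidence isometries and primitive admissible icosians *)

(** Replacing [q] by [a q] multiplies [q x (twist q)] by [a] times its conjugate, a rational number
    that [c] absorbs. A nonzero image [v_i] guarantees that [q] is nonzero. *)
Lemma twisted_similarity_primitive b v c q f i :
  twisted_similarity b v c q f -> tnth v i != 0 ->
  exists c' q', [/\ icosian q', primitive q' & twisted_similarity b v c' q' f].
Proof.
move=> sim vi0.
have q0 : q != 0.
  apply: contra vi0 => /eqP q0.
  by rewrite sim q0 /qtwo_sided -(scale0r 0) !qmulZl !scale0r scaler0.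
have [a [a0 Iq prim]] := primitive_multiple q0.
exists (c * fieldnormK a^-1), (a *: q); split=> // j; rewrite sim rmorphM -scalerA /=.
congr (_ *: _); rewrite /qtwo_sided twistZ !(qmulZl, qmulZr) !scalerA -mulK_conj.
rewrite fmorphV [X in X *: _](_ : _ = 1) ?scale1r //.
have ca0 : conjK a != 0 by rewrite fmorph_eq0.
by field; rewrite ca0 a0.
Qed.

Section Coincidence.
Variable R : realType.
Local Notation L := (A4_lattice R).
Local Notation b i := (realH R (tnth A4_gens i)).

(** A basis [S] of a common sublattice is both [X B] and [Y B A] with integer matrices [X], [Y],
    where [B] has the generators as rows. Hence [B A = Y^-1 X B]: the isometry preserves the
    rational span of L. *)
Lemma coincidence_lift (A : 'M[R]_4) : coincidence_isometry A ->
  exists v : 4.-tuple 'rV[Qsqrt5]_4,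
    (forall i, twist (tnth v i) = tnth v i) /\
    (forall i, realH R (tnth v i) = b i *m A).
Proof.
move=> [_ [P [[s /basis_ofP us PE] PL PA]]].
have sP i : P (tnth s i) by rewrite PE; apply: inIntSpan_gen.
have /fin_all_exists[X XE] i := (A4P _).1 (PL _ (sP i)).
have /fin_all_exists[Y YE] i : exists a : 'I_4 -> int,
    tnth s i = (\sum_(j < 4) (a j)%:~R *: b j) *m A.
  by have [v /A4P[a ->] <-] := PA _ (sP i); exists a.
pose ratM (Z : 'I_4 -> 'I_4 -> int) : 'M[rat]_4 := \matrix_(i, j) (Z i j)%:~R.
set S := (\matrix_i tnth s i) in us.
pose B := \matrix_i b i.
have sumE (Z : 'I_4 -> 'I_4 -> int) i :
    \sum_(j < 4) (Z i j)%:~R *: b j = row i (map_mx (@ratr R) (ratM Z) *m B).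
  rewrite row_mul mulmx_sum_row; apply: eq_bigr => j _.
  by rewrite rowK !mxE ratr_int.
have SX : S = map_mx (@ratr R) (ratM X) *m B.
  by apply/row_matrixP => i; rewrite rowK XE sumE.
have SY : S = map_mx (@ratr R) (ratM Y) *m (B *m A).
  by apply/row_matrixP => i; rewrite rowK YE sumE -row_mul mulmxA.
have uY : ratM Y \in unitmx.
  by move: us; rewrite SY unitmx_mul map_unitmx => /andP[].
pose C := invmx (ratM Y) *m ratM X.
have BA : B *m A = map_mx (@ratr R) C *m B.
  by rewrite map_mxM map_invmx -mulmxA -SX SY mulKmx ?map_unitmx.
exists [tuple \sum_(j < 4) ratK (C i j) *: tnth A4_gens j | i < 4].
split=> i; rewrite tnth_mktuple; first exact/twist_sum/twist_A4_gens.
rewrite realH_sum; transitivity (row i (B *m A)); last by rewrite row_mul rowK.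
rewrite BA row_mul mulmx_sum_row; apply: eq_bigr => j _.
by rewrite rowK !mxE realK_rat.
Qed.

Lemma isometry_image_twisted (A : 'M[R]_4) : coincidence_isometry A ->
  exists q, [/\ icosian q, primitive q, admissible R q &
                isometry_image A L = twisted_image R q].
Proof.
move=> cA; have [v [tv vA]] := coincidence_lift cA.
have iso := (isometry_qdot A).1 cA.1.
have dv i j : qdot (tnth v i) (tnth v j) = qdot (tnth A4_gens i) (tnth A4_gens j).
  by apply: (fmorph_inj (@realK R)); rewrite /= -!realH_qdot !vA iso.
have gen0 : qdot (tnth A4_gens 0) (tnth A4_gens 0) = 1.
  by rewrite A4_genE /qdot !quatE; ring.
have v0 : tnth v 0 != 0.
  apply/eqP => v0; move: (dv 0 0); rewrite v0 gen0 /qdot !mxE !mul0r !addr0.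
  by move/eqP; rewrite eq_sym oner_eq0.
have [c0 [q0 [f sim0]]] := twisted_similarity_isometry twist_A4_gens tv dv.
have [c [q [Iq prim sim]]] := twisted_similarity_primitive sim0 v0.
set m := fieldnormK (qdot q q).
(* The first generator is the unit quaternion, so its image has length 1. *)
have cm : c ^+ 2 * m = 1.
  have := dv 0 0; rewrite sim qdotZ qdot_two_sided qdot_conj_if gen0 mulr1.
  by rewrite qdot_twist mulK_conj -rmorphXn -rmorphM => -[].
have c0' : c != 0.
  by apply: contra_eq_neq cm => ->; rewrite expr0n mul0r eq_sym oner_eq0.
have mE : m = `|c|^-1 ^+ 2.
  by rewrite exprVn real_normK ?num_real // -[RHS]mulr1 -cm mulKf ?expf_neq0.
have [n cn] : exists n : nat, `|c|^-1 = n%:R.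
  apply: rat_sqrt_int; first by rewrite invr_ge0.
  rewrite -mE /m; have [k ->] := golden_norm_int (golden_qdot_icosian Iq).
  exact: intr_int.
have n0 : (0 < n)%N by rewrite -(ltr_nat rat) -cn invr_gt0 normr_gt0.
have qn : qtwist_norm R q = n%:R.
  apply/eqP; rewrite -(@eqrXn2 _ 2) ?sqrtr_ge0 ?ler0n // qtwist_norm_sqr -/m.
  by rewrite mE cn rmorphXn /= ratr_nat.
have cE : ratr c = (sgz c)%:~R * n%:R^-1 :> R.
  rewrite {1}[c]numEsg sgrEz rmorphM /= ratr_int -[`|c|]invrK cn fmorphV.
  by rewrite /= ratr_nat.
(* The sign of [c] and the possible conjugation form an involution of L, so precomposing with it
   leaves the image of L unchanged. *)
pose g (x : 'rV[R]_4) : 'rV[R]_4 := (sgz c)%:~R *: qconj_if f x.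
have gL x : L x -> L (g x).
  by move=> Lx; apply: A4Z; case: (f) => //; apply: A4_conj.
have gK x : g (g x) = x.
  rewrite /g linearZ /= qconj_ifK scalerA -rmorphM -sgzM.
  by rewrite gtr0_sgz ?scale1r // -expr2 exprn_even_gt0.
have xA x : L x ->
    x *m A = (qtwist_norm R q)^-1 *: qtwo_sided (realH R q) (realH R (twist q)) (g x).
  move=> /A4P[a ->]; rewrite qn /g linearZ /= scalerA [n%:R^-1 * _]mulrC -cE.
  rewrite mulmx_suml !linear_sum /=; apply: eq_bigr => i _.
  rewrite -scalemxAl -vA sim !linearZ /=.
  congr (_ *: _); rewrite realHZ realK_rat; congr (_ *: _).
  by rewrite /qtwo_sided !realH_qmul realH_conj_if.
exists q; split=> //; first by exists n.
apply/seteqP; split=> y [x Lx <-]; exists (g x); try exact: gL.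
  by rewrite xA.
by rewrite xA ?gK //; apply: gL.
Qed.

(** The map [x |-> q x (twist q)] scales lengths by [|q (twist q)|], so dividing by that number
    gives an isometry. It preserves the vectors fixed by the twist, so some nonzero integer multiple
    of each generator's image lies in L. *)
Lemma twisted_image_isometry q : admissible R q ->
  exists2 A : 'M[R]_4, coincidence_isometry A &
    isometry_image A L = twisted_image R q.
Proof.
move=> [n n0 qn].
pose T := qtwo_sided (realH R q) (realH R (twist q)).
pose A : 'M[R]_4 := n%:R^-1 *: lin1_mx T.
have AE x : x *m A = n%:R^-1 *: T x by rewrite -scalemxAr mul_rV_lin1.
have nn0 : n%:R != 0 :> R by rewrite pnatr_eq0 -lt0n.
have iso : A *m A^T = 1%:M.
  apply/isometry_qdot => x y; rewrite !AE qdotZ qdot_two_sided.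
  rewrite !realH_qdot qdot_twist -rmorphM mulK_conj /= realK_rat -qtwist_norm_sqr qn.
  by rewrite mulrA -exprMn mulVf // expr1n mul1r.
exists A; last first.
  rewrite /isometry_image /twisted_image qn; congr image.
  by apply/funext => x; rewrite AE.
split=> //.
have /fin_all_exists2[k k0 kL] i := A4_multiple R (two_sided_twist q (twist_A4_gens i)).
pose K := \prod_i k i.
have K0 : K != 0 by apply/prodf_neq0.
(* The factor [n] cancels the denominator of [A] and [K] those of the images, which puts [s] in L;
   as [K n] is an integer, [s] is also in the image of L. *)
pose s : 4.-tuple 'rV[R]_4 := [tuple (K%:~R * n%:R) *: (b i *m A) | i < 4].
have sL i : L (tnth s i).
  rewrite tnth_mktuple AE scalerA mulfK // /K (bigD1 i) //= mulrC rmorphM /= -scalerA.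
  by apply: A4Z; have := kL i; rewrite /qtwo_sided !realH_qmul.
exists [set v | inIntSpan s v]%classic; split.
- exists s => //; apply/basis_ofP.
  have -> : \matrix_i tnth s i = (K%:~R * n%:R) *: ((\matrix_i b i) *m A).
    apply/row_matrixP => i; rewrite rowK tnth_mktuple.
    by rewrite [RHS]linearZ /= row_mul rowK.
  rewrite unitmxZ ?unitfE ?mulf_neq0 ?intr_eq0 // unitmx_mul A4_matrix_unit /=.
  by case/mulmx1_unit: iso.
- by move=> v /= /inIntSpanP[a ->]; apply: A4_sum.
- move=> v /= /inIntSpanP[a ->].
  exists (\sum_(i < 4) (a i * K * n%:Z)%:~R *: b i).
    by apply/A4P; exists (fun i => a i * K * n%:Z).
  rewrite mulmx_suml; apply: eq_bigr => i _.
  by rewrite tnth_mktuple -scalemxAl scalerA !rmorphM /= mulrA.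
Qed.

End Coincidence.

Theorem theorem1 (R : realType) (M : set 'rV[R]_4) :
  (exists2 A : 'M[R]_4, coincidence_isometry A & M = csl A) <->
  (exists q : 'rV[Qsqrt5]_4,
     [/\ icosian q, primitive q, admissible R q &
         M = (A4_lattice R `&` twisted_image R q)%classic]).
Proof.
split=> [[A cA ->]|[q [_ _ adm ->]]].
  have [q [Iq prim adm AE]] := isometry_image_twisted cA.
  by exists q; split=> //; rewrite /csl AE.
have [A cA AE] := twisted_image_isometry adm.
by exists A => //; rewrite /csl AE.
Qed.
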